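(* Let $m\ge 2$. Then the orthogonal projection $P_{\rm orth}$ is the unique invariant projection of the edge space of the $m$-dimensional discrete torus $\mathbb{Z}_4^m$ onto its cycle space $Z(\mathbb{Z}_4^m)$.
   Context: $\mathbb{Z}_n^m$ is regarded as the graph with vertex set $\mathbb{Z}_n^m$ in which two vertices are adjacent if and only if they differ in exactly one coordinate and in that coordinate differ by $\pm1$ mod $n$. For a finite graph $G=(V,E)$ with a fixed arbitrary orientation of edges (tail $e^-$, head $e^+$), the cycle space is $Z(G)=\{F\in\mathbb{R}^E:\ \sum_{e^+=v}F(e)=\sum_{e^-=v}F(e)\text{ for all }v\in V\}$. For an edge $uv$, $\overrightarrow{uv}\in\mathbb{R}^E$ is its unit basis vector if it is oriented from $u$ to $v$, and $\overrightarrow{vu}=-\overrightarrow{uv}$. Each graph automorphism $\phi$ induces the linear map $\hat\phi$ of $\mathbb{R}^E$ with $\hat\phi(\overrightarrow{uv})=\overrightarrow{\phi(u)\phi(v)}$. A linear projection $P$ of $\mathbb{R}^E$ onto $Z(G)$ is invariant if $P\hat\phi=\hat\phi P$ for every graph automorphism $\phi$ (for these $3$-connected graphs the linear isometries of $\ell_1(E)$ preserving $Z(G)$ are, up to sign, exactly the $\hat\phi$). $P_{\rm orth}$ is orthogonal with respect to the standard inner product on $\mathbb{R}^E$. *)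

(* Defs.v *)
From HB Require Import structures.
From mathcomp Require Import all_boot all_order all_fingroup all_algebra.
From mathcomp Require Import sesquilinear reals.
Set Implicit Arguments.
Unset Strict Implicit.
Unset Printing Implicit Defensive.
Import Order.TTheory GRing.Theory Num.Theory.
Local Open Scope ring_scope.

Record sgraph := SGraph {
  vertex :> finType;
  adj : rel vertex;
  adj_sym : symmetric adj;
  adj_irr : irreflexive adj }.

Section Edges.
Variable G : sgraph.

Definition is_edge (A : {set G}) :=
  [exists u, exists v, adj u v && (A == [set u; v])].

Record edge := Edge { edge_set : {set G}; edge_setP : is_edge edge_set }.
HB.instance Definition _ := [isSub for edge_set].
HB.instance Definition _ := [Finite of edge by <:].

Record orientation := Orientation {
  etail : edge -> G;
  ehead : edge -> G;
  edge_setE : forall e, edge_set e = [set etail e; ehead e] }.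

Definition automorphism (phi : {perm G}) := {mono phi : u v / adj u v}.

End Edges.

Notation edge_space R G := {ffun edge G -> R^o}.

Section InnerProduct.
Variables (R : realType) (E : finType).
Local Notation space := {ffun E -> R^o}.
Implicit Types F H : space.

Definition dotp F H : R := \sum_e F e * H e.

Fact dotpC F H : dotp F H = (-1) ^+ false * idfun (dotp H F).
Proof. by rewrite expr0 mul1r; apply: eq_bigr => e _; rewrite mulrC. Qed.

Fact dotp_bilinear : bilinear_for
  (GRing.Scale.Law.clone _ _ *%R _) (GRing.Scale.Law.clone _ _ (idfun \; *%R) _)
  dotp.
Proof.
split=> [H|H] a F1 F2 /=; rewrite /dotp mulr_sumr -big_split /=;
  apply: eq_bigr => e _; rewrite !ffunE.
- by rewrite mulrDl mulrA.
- by rewrite mulrDr mulrCA.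
Qed.

HB.instance Definition _ :=
  @bilinear_isBilinear.Build R space space R _ _ dotp dotp_bilinear.
HB.instance Definition _ :=
  @isHermitianSesquilinear.Build R space false idfun dotp dotpC.

Definition orth_proj (U : {vspace space}) : 'End(space) :=
  daddv_pi U (orthov dotp U).

Lemma dotp_eq0 F : dotp F F = 0 -> F = 0.
Proof.
move/eqP; rewrite psumr_eq0; last by move=> e _; rewrite -expr2 sqr_ge0.
move=> /allP F0; apply/ffunP=> e; apply/eqP.
by have := F0 e (mem_index_enum e); rewrite /= mulf_eq0 orbb ffunE.
Qed.

Lemma capv_orthov (U : {vspace space}) : (U :&: orthov dotp U = 0)%VS.
Proof.
apply/eqP; rewrite -subv0; apply/subvP=> F /memv_capP[FU /mem_orthovP FU'].
by rewrite memv0; apply/eqP/dotp_eq0/FU'.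
Qed.

Lemma addv_orthov (U : {vspace space}) : (U + orthov dotp U = fullv)%VS.
Proof.
apply/eqP; rewrite eqEdim subvf /= (dimv_disjoint_sum (capv_orthov U)).
pose f (F : space) : space := \sum_(i < \dim U) dotp F (vbasis U)`_i *: (vbasis U)`_i.
have fL : linear f.
  move=> a F H; rewrite /f scaler_sumr -big_split /=; apply: eq_bigr => i _.
  by rewrite (linearPl (dotp : {bilinear _ -> _ -> _ | _ & _})) /= scalerDl scalerA.
pose fM := GRing.isLinear.Build R space space *:%R f fL.
pose g : {linear space -> space} := HB.pack f fM.
rewrite -(limg_ker_dim (linfun g) fullv) addnC leq_add //.
  apply/dimvS/subvP=> H /memv_imgP; case=> F _ ->; rewrite lfunE /=.
  by apply: rpred_sum => i _; rewrite rpredZ // vbasis_mem // mem_nth // size_tuple.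
apply/dimvS/subvP=> F; rewrite capfv memv_ker lfunE /= => /eqP F0.
apply/mem_orthovP => H /coord_vbasis ->.
rewrite (linear_sumr (dotp : {bilinear _ -> _ -> _ | _ & _})) big1 // => i _.
rewrite (linearZr_LR (dotp : {bilinear _ -> _ -> _ | _ & _})) /=.
have /freeP fr := basis_free (vbasisP U).
by rewrite (fr (fun i : 'I_(\dim U) => dotp F (vbasis U)`_i) F0) mulr0.
Qed.

Lemma orth_projP (U : {vspace space}) F :
  orth_proj U F \in U /\
  {in U, forall H, dotp (F - orth_proj U F) H = 0}.
Proof.
split; first exact: memv_pi.
apply/mem_orthovP; rewrite -[X in X - _](daddv_pi_add (capv_orthov U) (w := F)).
  by rewrite addrAC subrr add0r memv_pi.
by rewrite addv_orthov memvf.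
Qed.

End InnerProduct.

Section CycleSpace.
Variables (R : realType) (G : sgraph) (o : orientation G).
Local Notation space := (edge_space R G).

Definition excess (F : space) : {ffun G -> R^o} :=
  [ffun v => \sum_(e | ehead o e == v) F e - \sum_(e | etail o e == v) F e].

Fact excess_linear : linear excess.
Proof.
move=> a F H; apply/ffunP=> v; rewrite !ffunE scalerBr !scaler_sumr.
rewrite addrACA -opprD -!big_split /=.
by congr (_ - _); apply: eq_bigr => e _; rewrite !ffunE.
Qed.

HB.instance Definition _ :=
  GRing.isLinear.Build R space {ffun G -> R^o} *:%R excess excess_linear.

Definition cycle_space : {vspace space} := lker (linfun excess).

Lemma cycle_spaceP (F : space) :
  reflect (forall v, \sum_(e | ehead o e == v) F e = \sum_(e | etail o e == v) F e)
          (F \in cycle_space).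
Proof.
rewrite memv_ker lfunE; apply: (iffP eqP) => [/ffunP F0 v | F0].
  by have /eqP := F0 v; rewrite !ffunE subr_eq0 => /eqP.
by apply/ffunP=> v; rewrite !ffunE F0 subrr.
Qed.

(* For adjacent u and v: the basis vector of the edge uv, negated if that edge
   is oriented from v to u. *)
Definition arrow (u v : G) : space :=
  [ffun e => ((etail o e == u) && (ehead o e == v))%:R
           - ((etail o e == v) && (ehead o e == u))%:R].

Definition hat_fun (phi : {perm G}) (F : space) : space :=
  \sum_e F e *: arrow (phi (etail o e)) (phi (ehead o e)).

Fact hat_linear phi : linear (hat_fun phi).
Proof.
move=> a F H; rewrite /hat_fun scaler_sumr -big_split /=.
by apply: eq_bigr => e _; rewrite !ffunE scalerDl scalerA.
Qed.

HB.instance Definition _ phi :=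
  GRing.isLinear.Build R space space *:%R (hat_fun phi) (hat_linear phi).

Definition hat (phi : {perm G}) : 'End(space) := linfun (hat_fun phi).

Lemma arrowC u v : arrow v u = - arrow u v.
Proof. by apply/ffunP=> e; rewrite !ffunE opprB. Qed.

Lemma adj_tail_head e : adj (etail o e) (ehead o e).
Proof.
have /existsP[u /existsP[v /andP[uv /eqP]]] := edge_setP e.
have nuv : u != v by apply: contraTneq uv => ->; rewrite adj_irr.
rewrite (edge_setE o) => E.
have := set22 (etail o e) (ehead o e); have := set21 (etail o e) (ehead o e).
have := set22 u v; have := set21 u v; rewrite -{1 2}E {3 4}E !inE.
move=> hu hv ht hh.
case/orP: ht hu hv => /eqP ->; case/orP: hh => /eqP -> //.
- by rewrite !orbb [v == u]eq_sym (negPf nuv).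
- by rewrite adj_sym.
- by rewrite !orbb (negPf nuv).
Qed.

Lemma arrow_edge e e' : arrow (etail o e) (ehead o e) e' = (e' == e)%:R.
Proof.
rewrite ffunE.
have nth : etail o e != ehead o e.
  by apply: contraTneq (adj_tail_head e) => ->; rewrite adj_irr.
have [-> | ne] := eqVneq e' e; first by rewrite !eqxx (negPf nth) subr0.
have dist : forall b, b -> (b -> edge_set e' = edge_set e) -> False.
  by move=> b hb /(_ hb) /val_inj; apply/eqP.
case: andP => [[/eqP t /eqP h] | _].
  by case: (dist true isT) => _; rewrite !(edge_setE o) t h.
case: andP => [[/eqP t /eqP h] | _]; last by rewrite subr0.
by case: (dist true isT) => _; rewrite !(edge_setE o) t h setUC.
Qed.

Lemma hat_arrow phi u v :
  adj u v -> hat phi (arrow u v) = arrow (phi u) (phi v).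
Proof.
have base e : hat phi (arrow (etail o e) (ehead o e))
              = arrow (phi (etail o e)) (phi (ehead o e)).
  rewrite lfunE /= /hat_fun (bigD1 e) //= arrow_edge eqxx scale1r.
  by rewrite big1 ?addr0 // => e' /negPf ne; rewrite arrow_edge ne scale0r.
move=> uv; have uvE : is_edge [set u; v].
  by apply/existsP; exists u; apply/existsP; exists v; rewrite uv eqxx.
have := edge_setE o (Edge uvE); have := base (Edge uvE).
have nuv : u != v by apply: contraTneq uv => ->; rewrite adj_irr.
set t := etail _ _; set h := ehead _ _ => /= hE E.
have := set21 u v; have := set22 u v; rewrite E !inE.
move=> /orP[]/eqP hv /orP[]/eqP hu; move: nuv; rewrite hu hv ?eqxx // => _.
by rewrite arrowC linearN /= hE arrowC opprK.
Qed.

Definition projection_onto (U : {vspace space}) (P : 'End(space)) :=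
  (P \o P)%VF = P /\ limg P = U.

Definition aut_invariant (P : 'End(space)) :=
  forall phi : {perm G}, automorphism phi ->
    (P \o hat phi)%VF = (hat phi \o P)%VF.

Definition invariant_projection (P : 'End(space)) :=
  projection_onto cycle_space P /\ aut_invariant P.

End CycleSpace.

Section Torus.
Variables n m : nat.

(* 'Z_n is the ring of integers mod n only for n > 1. *)
Definition torus_adj (x y : {ffun 'I_m -> 'Z_n}) :=
  [exists i, [&& x i != y i, (y i == x i + 1) || (y i == x i - 1)
               & [forall j, (j != i) ==> (x j == y j)]]].

Fact torus_adj_sym : symmetric torus_adj.
Proof.
move=> x y; apply: eq_existsb => i.
have succ_pred (a b : 'Z_n) : (a == b + 1) = (b == a - 1).
  by rewrite [RHS]eq_sym subr_eq.
rewrite eq_sym; congr [&& _, _ & _]; last first.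
  by apply: eq_forallb => j; rewrite [x j == _]eq_sym.
by rewrite (succ_pred (y i)) -(succ_pred (x i) (y i)) orbC.
Qed.

Fact torus_adj_irr : irreflexive torus_adj.
Proof. by move=> x; apply/existsP=> -[i]; rewrite eqxx. Qed.

Definition torus : sgraph := SGraph torus_adj_sym torus_adj_irr.

End Torus.

(* Main.v *)
Require Import Defs.
From mathcomp Require Import all_boot all_order all_fingroup all_algebra.
From mathcomp Require Import reals.
Set Implicit Arguments.
Unset Strict Implicit.
Unset Printing Implicit Defensive.
Import Order.TTheory GRing.Theory Num.Theory.
Local Open Scope ring_scope.

(** [Z_4] is a 4-cycle, hence a 2-cube, so [Z_4^m] is the [2m]-cube. Two
    invariant projections onto the cycle space [Z] differ by an equivariant map
    [D] into [Z] that vanishes on [Z]. Since [R^E] is the sum of [Z] and of the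
    span of the vertex stars, it suffices that [D] kills the star of each vertex
    [w]. Its image is a cycle fixed by all automorphisms fixing [w]. Moving from
    [w] outwards, such a cycle vanishes: at a vertex [v], the edges towards [w]
    carry no flow by induction, while the edges away from [w] all carry the same
    flow, because swapping two cube coordinates that agree at [v] and [w] fixes
    both; conservation at [v] makes this common flow zero. *)

(** * Flows, stars and the action of automorphisms on edge space *)

Section EdgeSpace.
Variables (R : realType) (G : sgraph) (o : orientation G).
Local Notation space := (edge_space R G).
Implicit Types (F H : space) (u v w : G) (phi : {perm G}).

(** The value of [F] read along the direction from [u] to [v]. It hides the orientation [o] and is
    zero on non-adjacent pairs, so sums over neighbours may run over all vertices. *)
Definition flow F u v : R := dotp F (arrow R o u v).

Definition star v : space := \sum_u arrow R o u v.

Lemma dotpDl F1 F2 H : dotp (F1 + F2) H = dotp F1 H + dotp F2 H.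
Proof. by rewrite -big_split; apply: eq_bigr => e _; rewrite ffunE mulrDl. Qed.

Lemma dotpZl a F H : dotp (a *: F) H = a * dotp F H.
Proof. by rewrite [RHS]mulr_sumr; apply: eq_bigr => e _; rewrite ffunE mulrA. Qed.

Lemma dotpNl F H : dotp (- F) H = - dotp F H.
Proof. by rewrite -scaleN1r dotpZl mulN1r. Qed.

Lemma dotp_sym F H : dotp F H = dotp H F.
Proof. by apply: eq_bigr => e _; rewrite mulrC. Qed.

Lemma dotp_suml (I : finType) (f : I -> space) H :
  dotp (\sum_i f i) H = \sum_i dotp (f i) H.
Proof.
rewrite [RHS]exchange_big; apply: eq_bigr => e _.
by rewrite sum_ffunE mulr_suml.
Qed.

Lemma arrow_nadj u v : ~~ adj u v -> arrow R o u v = 0.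
Proof.
move=> nuv; apply/ffunP=> e; rewrite !ffunE.
have te := adj_tail_head o e.
case: andP => [[/eqP t /eqP h]|_]; first by rewrite t h (negPf nuv) in te.
case: andP => [[/eqP t /eqP h]|_]; last by rewrite subr0.
by rewrite t h adj_sym (negPf nuv) in te.
Qed.

Lemma flowC F u v : flow F u v = - flow F v u.
Proof. by rewrite /flow arrowC dotp_sym dotpNl dotp_sym. Qed.

Lemma flow_nadj F u v : ~~ adj u v -> flow F u v = 0.
Proof. by move=> nuv; apply: big1 => e _; rewrite arrow_nadj // ffunE mulr0. Qed.

Lemma flow_edge F e : flow F (etail o e) (ehead o e) = F e.
Proof.
rewrite /flow /dotp (bigD1 e) //= arrow_edge eqxx mulr1 big1 ?addr0 //.
by move=> e' /negPf ne; rewrite arrow_edge ne mulr0.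
Qed.

Lemma edge_sum F : F = \sum_e F e *: arrow R o (etail o e) (ehead o e).
Proof.
apply/ffunP=> e; rewrite sum_ffunE (bigD1 e) //= ffunE arrow_edge eqxx big1.
  by rewrite addr0 [RHS]mulr1.
by move=> e' ne; rewrite ffunE arrow_edge eq_sym (negPf ne) scaler0.
Qed.

Lemma adj_edge u v : adj u v -> exists e,
  (etail o e = u /\ ehead o e = v) \/ (etail o e = v /\ ehead o e = u).
Proof.
move=> uv; have uvE : is_edge [set u; v].
  by apply/existsP; exists u; apply/existsP; exists v; rewrite uv eqxx.
exists (Edge uvE); have := adj_tail_head o (Edge uvE).
have := edge_setE o (Edge uvE); set t := etail _ _; set h := ehead _ _ => /= E.
have := set21 t h; have := set22 t h; rewrite -E !inE.
by move=> /orP[]/eqP-> /orP[]/eqP->; rewrite ?adj_irr //; [right|left].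
Qed.

Lemma flow_arrow a b u v : adj u v ->
  flow (arrow R o a b) u v
  = ((u == a) && (v == b))%:R - ((u == b) && (v == a))%:R.
Proof.
case/adj_edge=> e [[<- <-]|[<- <-]]; first by rewrite flow_edge ffunE.
by rewrite flowC flow_edge ffunE opprB; congr (_%:R - _%:R); rewrite andbC.
Qed.

(** By linearity it suffices to take [F] an arrow, where both sides compare endpoints and [phi] is
    injective. *)
Lemma flow_hat phi F u v : automorphism phi ->
  flow (hat R o phi F) (phi u) (phi v) = flow F u v.
Proof.
move=> aut; have [uv|nuv] := boolP (adj u v); last first.
  by rewrite !flow_nadj ?aut.
rewrite {2}[F]edge_sum lfunE /= /hat_fun /flow !dotp_suml.
apply: eq_bigr => e _; rewrite !dotpZl; congr (_ * _).
have := flow_arrow; rewrite /flow => fa.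
by rewrite !fa ?aut // !(inj_eq perm_inj).
Qed.

Lemma flow_inj F H : (forall u v, adj u v -> flow F u v = flow H u v) -> F = H.
Proof.
move=> FH; apply/ffunP=> e.
by rewrite -[LHS]flow_edge -[RHS]flow_edge FH // adj_tail_head.
Qed.

(** An automorphism permutes the standard basis up to signs, so it acts by isometries. *)
Lemma dotp_hat phi F H : automorphism phi ->
  dotp (hat R o phi F) (hat R o phi H) = dotp F H.
Proof.
move=> aut; rewrite {1}[H]edge_sum {2}[H]edge_sum linear_sum.
rewrite dotp_sym [RHS]dotp_sym !dotp_suml; apply: eq_bigr => e _.
rewrite linearZ /= !dotpZl hat_arrow ?adj_tail_head //.
by rewrite dotp_sym [in RHS]dotp_sym [X in _ * X]flow_hat.
Qed.

Lemma automorphismV phi : automorphism phi -> automorphism phi^-1%g.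
Proof. by move=> aut u v; rewrite -aut !permKV. Qed.

Lemma hatKV phi F : automorphism phi -> hat R o phi (hat R o phi^-1%g F) = F.
Proof.
move=> aut; apply: flow_inj => u v _.
rewrite -{1}[u](permKV phi) -{1}[v](permKV phi) flow_hat //.
by rewrite flow_hat //; apply: automorphismV.
Qed.

Lemma hat_star phi v : automorphism phi -> hat R o phi (star v) = star (phi v).
Proof.
move=> aut; rewrite /star linear_sum [RHS](reindex_inj (@perm_inj _ phi)) /=.
apply: eq_bigr => u _; have [uv|nuv] := boolP (adj u v).
  exact: hat_arrow.
by rewrite !arrow_nadj ?aut // linear0.
Qed.

Lemma sum_flow F v : \sum_u flow F u v = dotp F (star v).
Proof.
by rewrite dotp_sym dotp_suml; apply: eq_bigr => u _; rewrite dotp_sym.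
Qed.

(** This turns conservation at [v] into orthogonality to [star v]: the cycle space is the orthogonal
    complement of the span of the stars. *)
Lemma dotp_star F v :
  dotp F (star v) = \sum_(e | ehead o e == v) F e - \sum_(e | etail o e == v) F e.
Proof.
rewrite -sum_flow /flow exchange_big /= [in RHS]big_mkcond /=.
rewrite [X in _ - X]big_mkcond -sumrB; apply: eq_bigr => e _ /=.
rewrite -mulr_sumr.
have pick1 (b : bool) (a : G) :
    \sum_(u : G) ((a == u) && b)%:R = b%:R :> R.
  by rewrite (bigD1 a) //= eqxx big1 ?addr0 // => u /negPf; rewrite eq_sym => ->.
under eq_bigr => u _ do rewrite ffunE.
rewrite sumrB pick1; under [X in _ - X]eq_bigr => u _ do rewrite andbC.
rewrite pick1 mulrBr.
by do 2!case: (_ == v); rewrite /= ?mulr1 ?mulr0.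
Qed.

Lemma cycle_starP F :
  reflect (forall v, dotp F (star v) = 0) (F \in cycle_space R o).
Proof.
apply: (iffP (cycle_spaceP _ _)) => [E v | E v].
  by rewrite dotp_star E subrr.
by apply/eqP; rewrite -subr_eq0 -dotp_star E.
Qed.

Lemma hat_cycle phi F : automorphism phi ->
  F \in cycle_space R o -> hat R o phi F \in cycle_space R o.
Proof.
move=> aut /cycle_starP FZ; apply/cycle_starP=> v.
by rewrite -[v](permKV phi) -hat_star // dotp_hat.
Qed.

(** * Orthogonal projection and uniqueness of invariant projections *)

(** The difference of two candidates lies in [U] and is orthogonal to [U], so it is orthogonal to
    itself. *)
Lemma orth_proj_unique (U : {vspace space}) F H :
  H \in U -> {in U, forall K, dotp (F - H) K = 0} -> orth_proj U F = H.
Proof.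
move=> HU HF; have [PU PF] := orth_projP U F.
apply/eqP; rewrite -subr_eq0; apply/eqP/dotp_eq0.
set K := _ - H; have KU : K \in U by rewrite rpredB.
have -> : dotp K K = dotp ((F - H) - (F - orth_proj U F)) K.
  by rewrite opprB addrC addrA addrNK.
by rewrite dotpDl dotpNl HF ?PF // subrr.
Qed.

Lemma orth_proj_projection (U : {vspace space}) : projection_onto U (orth_proj U).
Proof.
have PU F : F \in U -> orth_proj U F = F.
  move=> FU; apply: orth_proj_unique => // K _.
  by rewrite subrr; apply: big1 => e _; rewrite ffunE mul0r.
split; first by apply/lfunP=> F; rewrite comp_lfunE PU //; case: (orth_projP U F).
apply/eqP; rewrite eqEsubv; apply/andP; split; apply/subvP=> F.
  by case/memv_imgP=> H _ ->; case: (orth_projP U H).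
by move=> FU; rewrite -[F]PU // memv_img ?memvf.
Qed.

(** Each [hat phi] is an isometry mapping the cycle space onto itself, hence it respects the
    orthogonal decomposition. *)
Lemma orth_proj_invariant :
  invariant_projection o (orth_proj (cycle_space R o)).
Proof.
split; first exact: orth_proj_projection.
move=> phi aut; apply/lfunP=> F; rewrite !comp_lfunE.
have [PZ PF] := orth_projP (cycle_space R o) F.
apply: orth_proj_unique; first exact: hat_cycle.
move=> K KZ; rewrite -linearB /= -[K](hatKV _ aut) dotp_hat // PF //.
by apply: hat_cycle => //; apply: automorphismV.
Qed.

Lemma projection_onto_id (U : {vspace space}) P F :
  projection_onto U P -> F \in U -> P F = F.
Proof.
by case=> PP <- /memv_imgP[H _ ->]; rewrite -comp_lfunE PP.
Qed.

Lemma invariant_projection_unique P Q :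
  (forall w F, F \in cycle_space R o ->
     (forall phi, automorphism phi -> phi w = w -> hat R o phi F = F) -> F = 0) ->
  @invariant_projection R G o P -> @invariant_projection R G o Q -> P = Q.
Proof.
move=> fix0 [Pproj Pinv] [Qproj Qinv].
have star0 w : (P - Q) (star w) = 0.
  apply: (fix0 w) => [|phi aut pw].
    rewrite add_lfunE opp_lfunE rpredB //.
      by rewrite -(proj2 Pproj) memv_img ?memvf.
    by rewrite -(proj2 Qproj) memv_img ?memvf.
  have PQ : ((P - Q) \o hat R o phi)%VF = (hat R o phi \o (P - Q))%VF.
    by rewrite comp_lfunDl comp_lfunDr comp_lfunNl comp_lfunNr Pinv ?Qinv.
  by rewrite -comp_lfunE -PQ comp_lfunE hat_star // pw.
pose W := <<[seq star w | w : G]>>%VS.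
have W0 : (W <= lker (P - Q))%VS.
  by apply/span_subvP=> _ /mapP[w _ ->]; rewrite memv_ker star0.
apply/eqP; rewrite -subr_eq0; apply/eqP/lfunP=> F; rewrite zero_lfunE.
have [pW pF] := orth_projP W F.
rewrite -[F](subrK (orth_proj W F)) linearD /=.
have -> : (P - Q) (orth_proj W F) = 0 by apply/eqP; rewrite -memv_ker (subvP W0).
(* The residue is orthogonal to every star, hence a cycle, and both projections fix it. *)
have FZ : F - orth_proj W F \in cycle_space R o.
  by apply/cycle_starP=> v; apply/pF/memv_span/map_f; rewrite mem_enum.
rewrite addr0 add_lfunE opp_lfunE.
by rewrite (projection_onto_id Pproj) ?(projection_onto_id Qproj) ?subrr.
Qed.

End EdgeSpace.

(** * Hamming distance and weight on bit vectors *)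

Section Cube.
Variable I : finType.
Implicit Types x y : {ffun I -> bool}.

Definition hamming x y := (\sum_i (x i != y i))%N.

Definition weight x := (\sum_i x i)%N.

Lemma hamming1 x y : hamming x y = 1%N ->
  exists i, x i != y i /\ forall j, j != i -> x j = y j.
Proof.
move=> /eqP/sum_nat_eq1[] i [_ xi xj]; exists i; split.
  by move: xi; case: (_ != _).
by move=> j ji; have := xj j ji isT; case: eqP.
Qed.

Lemma weight_flip x y i : x i -> ~~ y i -> (forall j, j != i -> x j = y j) ->
  weight x = (weight y).+1.
Proof.
move=> xi yi xy; rewrite /weight (bigD1 i) //= xi [in RHS](bigD1 i) //=.
by rewrite (negPf yi) add0n; congr _.+1; apply: eq_bigr => j /xy ->.
Qed.

End Cube.

(** * Cycles on graphs isomorphic to a hypercube *)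

Section CubeGraph.
Variables (R : realType) (G : sgraph) (o : orientation G) (I : finType).

Definition cube_coord (b : G -> {ffun I -> bool}) :=
  bijective b /\ forall u v, adj u v = (hamming (b u) (b v) == 1%N).

(** Adding [b w] modulo 2 preserves Hamming distances and sends [b w] to zero. *)
Lemma cube_coord_center b w : cube_coord b ->
  exists2 b', cube_coord b' & forall i, ~~ b' w i.
Proof.
move=> [[g bK gK] adjE].
pose t (x : {ffun I -> bool}) := [ffun i => x i (+) b w i].
have tK : involutive t.
  by move=> x; apply/ffunP=> i; rewrite !ffunE -addbA addbb addbF.
exists (t \o b); last by move=> i; rewrite /= ffunE addbb.
split; first by exists (g \o t) => u /=; rewrite ?tK ?bK ?gK ?tK.
move=> u v; rewrite adjE; congr (_ == _); apply: eq_bigr => i _ /=.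
by rewrite !ffunE; case: (b u i); case: (b v i); case: (b w i).
Qed.

Lemma cube_coord_perm b (s : {perm I}) : cube_coord b ->
  exists2 phi : {perm G}, automorphism phi &
    forall u i, b (phi u) i = b u (s i).
Proof.
move=> [[g bK gK] adjE].
pose f u := g [ffun i => b u (s i)].
have bf u i : b (f u) i = b u (s i) by rewrite gK ffunE.
have f_inj : injective f.
  move=> u v fuv; apply: (can_inj bK); apply/ffunP=> i.
  by rewrite -[i](permKV s) -!bf fuv.
exists (perm f_inj); last by move=> u i; rewrite permE.
move=> u v; rewrite !adjE !permE; congr (_ == _).
rewrite /hamming [RHS](reindex_inj (@perm_inj _ s)).
by apply: eq_bigr => i _; rewrite !bf.
Qed.

(** Once [w] sits at the zero vector, [weight] is the distance from [w], and the outward induction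
    runs on it. *)
Lemma cube_fixed_cycle0 b w (F : edge_space R G) :
  cube_coord b -> F \in cycle_space R o ->
  (forall phi, automorphism phi -> phi w = w -> hat R o phi F = F) -> F = 0.
Proof.
move=> bP FZ Ffix; have {bP}[{}b bP bw] := cube_coord_center w bP.
have b_inj := bij_inj (proj1 bP); have adjE := proj2 bP.
have adj_flip u v : adj u v ->
    exists i, b u i != b v i /\ forall j, j != i -> b u j = b v j.
  by rewrite adjE => /eqP/hamming1.
have adj_weight u v : adj u v ->
    weight (b u) = (weight (b v)).+1 \/ weight (b v) = (weight (b u)).+1.
  case/adj_flip=> i []; case ui: (b u i); case vi: (b v i) => // _ uv.
    by left; apply: (@weight_flip _ _ _ i); rewrite ?ui ?vi.
  by right; apply: (@weight_flip _ _ _ i); rewrite ?ui ?vi // => j /uv.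
have adj_up u v : adj u v -> weight (b u) = (weight (b v)).+1 ->
    exists i, [/\ b u i, b v i = false & forall j, j != i -> b u j = b v j].
  case/adj_flip=> i []; case ui: (b u i); case vi: (b v i) => // _ uv.
    by exists i.
  (* A flip in the other direction would make the weight of [b u] exceed itself by 2. *)
  rewrite (@weight_flip _ (b v) (b u) i) ?ui ?vi // => [|j /uv //].
  by move/eqP; rewrite -addn2 -[X in X == _]addn0 eqn_add2l.
(* Strong induction on the weight [k] of the endpoint nearer to [w]. *)
have F0 k u v : adj u v -> weight (b v) = k -> weight (b u) = k.+1 ->
    flow o F u v = 0.
  elim/ltn_ind: k u v => k IHk u v uv vk uk.
  pose up x := adj x v && (weight (b x) == k.+1).
  have up_eq x : up x -> flow o F x v = flow o F u v.
    case/andP=> xv /eqP xk.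
    have [|i [ui vi uv_i]] := adj_up u v uv; first by rewrite uk vk.
    have [|j [xj vj xv_j]] := adj_up x v xv; first by rewrite xk vk.
    (* Going from [v] to [u] turns on bit [i], to [x] bit [j]. Both bits are off at [v] and [w], so
       exchanging them fixes [v] and [w] and sends [u] to [x]. *)
    have [phi aut bphi] := cube_coord_perm (tperm i j) bP.
    have phiw : phi w = w.
      apply/b_inj/ffunP=> p; rewrite bphi.
      by rewrite (negPf (bw _)) (negPf (bw _)).
    have phiv : phi v = v.
      by apply/b_inj/ffunP=> p; rewrite bphi; case: tpermP => // ->; rewrite vi vj.
    have phiu : phi u = x.
      apply/b_inj/ffunP=> p; rewrite bphi; case: tpermP => [->|->|/eqP pi /eqP pj].
      - have [ij|ij] := eqVneq i j; first by rewrite -[in LHS]ij ui ij xj.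
        by rewrite uv_i 1?eq_sym // xv_j // vi vj.
      - by rewrite ui xj.
      - by rewrite uv_i // xv_j.
    by rewrite -{1}(Ffix _ aut phiw) -phiu -{1}phiv flow_hat.
  (* A neighbour not farther from [w] has weight [k] minus 1, so induction applies to the reversed
     edge. *)
  have down0 x : ~~ up x -> flow o F x v = 0.
    rewrite /up; have [xv /= xk|xv _] := boolP (adj x v); last exact: flow_nadj.
    have [xk'|vx] := adj_weight x v xv; first by rewrite xk' vk eqxx in xk.
    rewrite flowC (IHk (weight (b x))) ?oppr0 -?vk -?vx //.
    by rewrite adj_sym.
  have /eqP: \sum_x flow o F x v = 0 by rewrite sum_flow; apply/cycle_starP.
  (* Conservation at [v] says that a multiple of the common flow is zero; the multiplicity is
     positive since [u] itself satisfies [up]. *)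
  rewrite (bigID up) /= [X in _ + X]big1 // addr0 (eq_bigr _ up_eq) sumr_const.
  rewrite mulrn_eq0 => /orP[|/eqP //]; rewrite (cardD1 u).
  by rewrite unfold_in /= /up uv uk eqxx.
apply: (@flow_inj _ _ o) => u v uv.
rewrite [RHS]/flow [RHS]big1 => [|e _]; last by rewrite ffunE mul0r.
case: (adj_weight u v uv) => E; first exact: F0 E.
by rewrite flowC (F0 _ _ _ _ erefl E) ?oppr0 // adj_sym.
Qed.

End CubeGraph.

(** * The torus as a hypercube *)

(** The Gray code 00, 01, 11, 10 of the residues 0 to 3, with bit [false] written first: cyclically
    consecutive residues differ in exactly one bit. *)
Definition gray (a : 'Z_4) (j : bool) : bool :=
  if j then (1 <= a <= 2)%N else (2 <= a)%N.

Definition torus_bits m (x : torus 4 m) : {ffun 'I_m * bool -> bool} :=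
  [ffun p => gray (x p.1) p.2].

(** The Hamming distance of two codes is the sum of the distances [h] over torus coordinates. It
    equals 1 exactly when one term is 1 (a step of the 4-cycle) and the others are 0 (equal
    coordinates). *)
Lemma torus_bits_coord m : cube_coord (@torus_bits m).
Proof.
pose ungray (c d : bool) : 'Z_4 :=
  if c then if d then 2%:R else 3%:R else if d then 1 else 0.
have grayK a : ungray (gray a false) (gray a true) = a.
  by apply/val_inj; case: a => [[|[|[|[|]]]] ?].
have ungrayK c d j : gray (ungray c d) j = if j then d else c.
  by case: c; case: d; case: j.
split.
  exists (fun y : {ffun 'I_m * bool -> bool} =>
    [ffun i => ungray (y (i, false)) (y (i, true))]) => [x|y].
    by apply/ffunP=> i; rewrite !ffunE grayK.
  by apply/ffunP=> -[i j]; rewrite !ffunE ungrayK; case: j.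
pose h (a c : 'Z_4) := (\sum_j (gray a j != gray c j))%N.
have h1 a c : (h a c == 1%N) = (a != c) && ((c == a + 1) || (c == a - 1)).
  rewrite /h big_bool.
  by case: a => [[|[|[|[|]]]] ?] //; case: c => [[|[|[|[|]]]] ?].
have h0 a c : (h a c == 0%N) = (a == c).
  rewrite /h big_bool.
  by case: a => [[|[|[|[|]]]] ?] //; case: c => [[|[|[|[|]]]] ?].
move=> x y.
have -> : hamming (torus_bits x) (torus_bits y) = (\sum_i h (x i) (y i))%N.
  rewrite pair_bigA; apply: eq_bigr => -[i j] _ /=.
  by rewrite !ffunE.
apply/existsP/sum_nat_eq1 => [[i /and3P[ne nb /forallP eq]]|[i [_ hi hj]]].
  exists i; split=> //; first by apply/eqP; rewrite h1 ne.
  by move=> j ji _; apply/eqP; rewrite h0; have := eq j; rewrite ji.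
exists i; move/eqP: hi; rewrite h1 => /andP[-> ->] /=.
by apply/forallP=> j; apply/implyP=> ji; rewrite -h0 hj.
Qed.

Theorem theorem36 (R : realType) (m : nat) (hm : (2 <= m)%N)
    (o : orientation (torus 4 m)) :
  unique (@invariant_projection R (torus 4 m) o)
         (orth_proj (cycle_space R o)).
Proof.
split=> [|P]; first exact: orth_proj_invariant.
apply: invariant_projection_unique; last exact: orth_proj_invariant.
by move=> w F; apply: cube_fixed_cycle0 (torus_bits_coord m).
Qed.
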